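(* Let $G=(V,E)$ be a simple finite connected $d$-regular graph on $n$ vertices whose Laplacian has exactly four distinct eigenvalues $0<\lambda_1<\lambda_2<\lambda_3$ (together with $0$). Let $u,v$ be two distinct vertices. Suppose that $\Delta_i(u,v)\ge 0$ for $i=1,2,3$, and that one of the following holds: (i) $L^2(u,v)-L(u,v)(\lambda_2+\lambda_3)\ge 0$ and $\Delta_{12}(u,v)\ge 0$; (ii) $L^2(u,v)-L(u,v)(\lambda_1+\lambda_2)\ge 0$, $\Delta_{13}(u,v)\le 0$, and $\lambda_1+\lambda_2-\lambda_3\ge 0$; (iii) $L^2(u,v)-L(u,v)(\lambda_1+\lambda_3)\ge 0$, $\Delta_{23}(u,v)\ge 0$, and $\lambda_1+\lambda_2-\lambda_3\ge 0$. Then the function $t\mapsto r_t(u,v):=\frac{H_t(u,v)}{H_t(u,u)}$ is monotonically non-decreasing on $[0,\infty)$.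
   Context: $L=\mathrm{Deg}-A$ is the graph Laplacian ($A$ adjacency matrix, $\mathrm{Deg}$ diagonal degree matrix), $L^2$ its matrix square with entries $L^2(u,v)$, and $H_t=e^{-tL}$ the heat kernel. For an eigenvalue $\lambda$ of $L$, $P_\lambda$ denotes the orthogonal projection onto the $\lambda$-eigenspace, so $L=\sum_\lambda \lambda P_\lambda$. Write $P_i=P_{\lambda_i}$ and define $\Delta_i(u,v)=P_i(u,u)-P_i(u,v)$ and $\Delta_{ij}(u,v)=P_i(u,v)P_j(u,u)-P_j(u,v)P_i(u,u)$ for $i,j\in\{1,2,3\}$. *)

(* Defs.v *)
From mathcomp Require Import all_boot all_order all_algebra.
From mathcomp Require Import all_classical all_reals all_analysis.
Set Implicit Arguments.
Unset Strict Implicit.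
Unset Printing Implicit Defensive.
Import Order.TTheory GRing.Theory Num.Theory numFieldNormedType.Exports.
Local Open Scope ring_scope.

(* Matrices indexed by a finite type V are square matrices of size #|V|, through
   the bijection enum_rank : V -> 'I_#|V|. *)
Definition entry (R : realType) (V : finType) (M : 'M[R]_#|V|) (u v : V) : R :=
  M (enum_rank u) (enum_rank v).

(* A simple graph is a symmetric irreflexive relation E on a finite type V. *)
Definition degree (V : finType) (E : rel V) (x : V) : nat :=
  #|[set y | E x y]|.

Definition adj_mx (R : realType) (V : finType) (E : rel V) : 'M[R]_#|V| :=
  \matrix_(i, j) (E (enum_val i) (enum_val j))%:R.

Definition deg_mx (R : realType) (V : finType) (E : rel V) : 'M[R]_#|V| :=
  diag_mx (\row_i (degree E (enum_val i))%:R).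

Definition laplacian (R : realType) (V : finType) (E : rel V) : 'M[R]_#|V| :=
  deg_mx R E - adj_mx R E.

(* The matrix exponential, as the entrywise sum of the power series
   \sum_k A ^+ k / k!; is_cvg_expmx below shows that these sums converge. *)
Definition expmx (R : realType) (n : nat) (A : 'M[R]_n) : 'M[R]_n :=
  \matrix_(i, j) limn (series (fun k : nat => k`!%:R^-1 * (A ^+ k) i j)).

Lemma is_cvg_expmx (R : realType) (n : nat) (A : 'M[R]_n) (i j : 'I_n) :
  cvgn (series (fun k : nat => k`!%:R^-1 * (A ^+ k) i j)).
Proof.
pose c := \sum_a \sum_b `|A a b|.
have lec a b : `|A a b| <= c.
  rewrite /c (bigD1 a)//= (bigD1 b)//= -addrA lerDl addr_ge0//.
    by rewrite sumr_ge0.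
  by apply: sumr_ge0 => x _; rewrite sumr_ge0.
have c0 : 0 <= c by apply: sumr_ge0 => x _; rewrite sumr_ge0.
have pw k a b : `|(A ^+ k) a b| <= (n%:R * c) ^+ k.
  elim: k a b => [|k IH] a b.
    by rewrite !expr0 mxE; case: (a == b); rewrite ?normr1 ?normr0.
  rewrite exprS mxE (le_trans (ler_norm_sum _ _ _))//.
  rewrite exprS -mulrA mulr_natl -[n in _ *+ n]card_ord -sumr_const.
  apply: ler_sum => b' _.
  by rewrite normrM ler_pM.
apply: normed_cvg; apply: (series_le_cvg _ _ _ (is_cvg_series_exp_coeff (n%:R * c))).
- by move=> k; exact: normr_ge0.
- by move=> k; rewrite /exp_coeff mulr_ge0// ?exprn_ge0// ?mulr_ge0.
- move=> k; rewrite /exp_coeff /= normrM ger0_norm ?invr_ge0// mulrC.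
  by rewrite ler_wpM2r ?invr_ge0.
Qed.

Definition heat_kernel (R : realType) (V : finType) (E : rel V) (t : R) :
    'M[R]_#|V| :=
  expmx (- t *: laplacian R E).

(* Orthogonal projection of R^n onto the lambda-eigenspace of A: eigenspace
   A lambda is a matrix whose rows span the space of row vectors w such that
   w *m A = lambda *: w, so that kermx (eigenspace A lambda)^T spans the
   orthogonal complement of that space.  MathComp's proj_mx acts on row vectors;
   an orthogonal projection is symmetric, so that this is also the matrix of the
   projection acting on column vectors when A is symmetric. *)
Definition eigenproj (R : realType) (n : nat) (A : 'M[R]_n) (lambda : R) :
    'M[R]_n :=
  proj_mx (eigenspace A lambda) (kermx (eigenspace A lambda)^T).

(* P_lambda(u, v) for the Laplacian. *)
Definition proj_entry (R : realType) (V : finType) (E : rel V) (lambda : R)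
    (u v : V) : R :=
  entry (eigenproj (laplacian R E) lambda) u v.

(* Delta_i(u, v) and Delta_ij(u, v), with lambda_i and lambda_j as arguments in
   place of the indices i and j. *)
Definition Delta (R : realType) (V : finType) (E : rel V) (li : R)
    (u v : V) : R :=
  proj_entry E li u u - proj_entry E li u v.

Definition DeltaPair (R : realType) (V : finType) (E : rel V) (li lj : R)
    (u v : V) : R :=
  proj_entry E li u v * proj_entry E lj u u
  - proj_entry E lj u v * proj_entry E li u u.

Definition heat_ratio (R : realType) (V : finType) (E : rel V) (u v : V)
    (t : R) : R :=
  entry (heat_kernel E t) u v / entry (heat_kernel E t) u u.

(* Main.v *)
(* Writing f t = H_t(u,v), g t = H_t(u,u), a_i = P_i(u,u), b_i = P_i(u,v) and
   c = P_0(u,u) = P_0(u,v), one has f = c + \sum_i b_i e^(-l_i t), likewise for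
   g, and f' g - f g' is
     c \sum_i l_i Delta_i e^(-l_i t)
       - \sum_(i < j) (l_i - l_j) Delta_ij e^(-(l_i + l_j) t).
   Multiply it by e^((l_j + l_k) t), where (i, j, k) is (1, 2, 3), (3, 1, 2) or
   (2, 3, 1) in cases (i), (ii) and (iii). The product is -L(u,v) >= 0 at t = 0,
   and it is non-decreasing: in its derivative divided by e^((l_j - l_i) t),
   every term is non-decreasing in t, and the value at t = 0 is
     b_i (l_j - l_i) (l_k - l_i) + c l_j l_k
       = L^2(u,v) - L(u,v) (l_j + l_k) >= 0. *)
Require Import Defs.
From mathcomp Require Import all_boot all_order all_algebra.
From mathcomp Require Import all_classical all_reals all_analysis.
From mathcomp Require Import spectral sesquilinear complex ring lra.
Set Implicit Arguments.
Unset Strict Implicit.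
Unset Printing Implicit Defensive.
Import Order.TTheory GRing.Theory Num.Theory numFieldNormedType.Exports.
Local Open Scope ring_scope.

(** * Spectral decomposition of a real symmetric matrix *)

(** Over [R[i]] the matrix becomes Hermitian, so the spectral theorem provides an invertible [P]
    whose rows are eigenvectors for real eigenvalues. Such an eigenvalue is already one of [A], and
    the inclusion of row spaces descends from [R[i]] to [R]. *)
Lemma sym_eigenspaces_full (R : realType) (n : nat) (A : 'M[R]_n) (s : seq R) :
  A^T = A -> {subset eigenvalue A <= s} ->
  (1%:M <= \sum_(i < size s) eigenspace A s`_i)%MS.
Proof.
move=> symA sA; set S := (\sum_(i < size s) _)%MS.
pose f : {rmorphism R -> R[i]} := real_complex R.
pose AC := map_mx f A.
have hermAC : AC \is hermsymmx.
  apply: realsym_hermsym.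
    apply/is_hermitianmxP.
    by rewrite expr0 scale1r map_mx_id// /AC map_trmx symA.
  by apply/mxOverP => i j; rewrite mxE complex_real.
have /orthomx_spectralP := hermitian_normalmx hermAC.
have := hermitian_spectral_diag_real hermAC.
have := spectral_unit AC.
set P := spectralmx AC; set D := spectral_diag AC => uP /mxOverP Dreal eAC.
rewrite -(map_submx f) map_mx1.
have : (P <= map_mx f S)%MS.
  apply/row_subP => i.
  have PAC : row i P *m AC = D 0 i *: row i P.
    rewrite eAC !mulmxA -row_mul mulmxV// -!row_mul mul1mx.
    by apply/rowP => j; rewrite mul_diag_mx !mxE.
  pose r := complex.Re (D 0 i).
  have fr : f r = D 0 i by apply: RRe_real; exact: Dreal.
  have rP0 : row i P != 0.
    apply: contraTneq uP => r0; rewrite unitmxE (expand_det_row _ i).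
    rewrite big1 ?unitr0// => j _.
    by move/rowP/(_ j): r0; rewrite !mxE => ->; rewrite mul0r.
  have sr : r \in s.
    apply: sA; rewrite -topredE /= -(eigenvalue_map f) fr.
    by apply/eigenvalueP; exists (row i P).
  have lt_r : (index r s < size s)%N by rewrite index_mem.
  apply: (@submx_trans _ _ _ _ _ _ (map_mx f (eigenspace A r))).
    by rewrite map_eigenspace fr; apply/eigenspaceP.
  by rewrite map_submx (sumsmx_sup (Ordinal lt_r))//= nth_index.
by apply: submx_trans; rewrite sub1mx row_full_unit.
Qed.

Lemma sym_eigenspace_ortho (R : realType) (n : nat) (A : 'M[R]_n) (a b : R) :
  A^T = A -> a != b -> eigenspace A a *m (eigenspace A b)^T = 0.
Proof.
move=> symA neq_ab; set Ea := eigenspace A a; set Eb := eigenspace A b.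
have ea : Ea *m A = a *: Ea by apply/eigenspaceP.
have eb : Eb *m A = b *: Eb by apply/eigenspaceP.
have AEb : A *m Eb^T = b *: Eb^T by rewrite -[in LHS]symA -trmx_mul eb linearZ.
have : (a - b) *: (Ea *m Eb^T) = 0.
  by rewrite scalerBl scalemxAl -ea -mulmxA AEb -scalemxAr subrr.
by move/eqP; rewrite scaler_eq0 subr_eq0 (negPf neq_ab) => /eqP.
Qed.

Lemma mulmx_tr_eq0 (R : realType) (m n : nat) (B : 'M[R]_(m, n)) :
  B *m B^T = 0 -> B = 0.
Proof.
move=> BB0; apply/matrixP => i j; rewrite mxE.
have := congr1 (fun M : 'M[R]_m => M i i) BB0; rewrite !mxE.
under eq_bigr do rewrite mxE -expr2.
move/psumr_eq0P => /(_ (fun k _ => sqr_ge0 (B i k))) /(_ j isT) /eqP.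
by rewrite sqrf_eq0 => /eqP.
Qed.

(** This trivial intersection is the side condition under which [proj_mx] fixes its first space and
    kills its second one. *)
Lemma capmx_ortho (R : realType) (m n : nat) (U : 'M[R]_(m, n)) :
  (U :&: kermx U^T)%MS = 0.
Proof.
apply: mulmx_tr_eq0; set W := (_ :&: _)%MS.
have /submxP[D eD] : (W <= U)%MS by exact: capmxSl.
have /sub_kermxP W0 : (W <= kermx U^T)%MS by exact: capmxSr.
by rewrite [X in _ *m X^T]eD trmx_mul mulmxA W0 mul0mx.
Qed.

Section SpectralDecomposition.
Context (R : realType) (n : nat) (A : 'M[R]_n) (s : seq R).
Hypotheses (symA : A^T = A) (uniq_s : uniq s) (sA : {subset eigenvalue A <= s}).
Local Notation P := (eigenproj A).

Lemma eigenproj_sub (a : R) : (P a <= eigenspace A a)%MS.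
Proof. by rewrite -[P a]mul1mx proj_mx_sub. Qed.

Lemma eigenproj_mulmx (a : R) : P a *m A = a *: P a.
Proof. exact/eigenspaceP/eigenproj_sub. Qed.

(** Decompose the identity along the eigenspaces and multiply by one [P a] on the right: its own
    component is fixed, and the others are killed because they lie in the orthogonal complement. *)
Lemma eigenproj_sum : \sum_(a <- s) P a = 1%:M.
Proof.
have /sub_sumsmxP[D eD] := sym_eigenspaces_full symA sA.
rewrite (big_nth 0) big_mkord [RHS]eD; apply: eq_bigr => j _.
rewrite -[LHS]mul1mx eD mulmx_suml (bigD1 j)//= big1 => [|i neq_ij].
  by rewrite addr0 proj_mx_id ?capmx_ortho// submxMl.
rewrite proj_mx_0 ?capmx_ortho//; apply/sub_kermxP.
by rewrite -mulmxA sym_eigenspace_ortho ?mulmx0// nth_uniq.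
Qed.

(** Multiplying the resolution of the identity by [(P a)^T] leaves only [P a *m (P a)^T = (P a)^T],
    whose left side is symmetric. The identity exhibits diagonal entries of [P a] as sums of
    squares. *)
Lemma eigenproj_gram (a : R) : a \in s -> P a *m (P a)^T = P a.
Proof.
move=> sa; have ortho b : b != a -> P b *m (P a)^T = 0.
  move=> neq_ba.
  have /submxP[Db ->] := eigenproj_sub b.
  have /submxP[Da ->] := eigenproj_sub a.
  by rewrite trmx_mul mulmxA -(mulmxA Db) sym_eigenspace_ortho ?mulmx0 ?mul0mx.
have eP : P a *m (P a)^T = (P a)^T.
  rewrite -[RHS]mul1mx -eigenproj_sum mulmx_suml (bigD1_seq a)//=.
  by rewrite big1 ?addr0.
by have := congr1 trmx eP; rewrite trmx_mul trmxK.
Qed.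

Lemma mx_exp_eigen (k : nat) : A ^+ k = \sum_(a <- s) a ^+ k *: P a.
Proof.
elim: k => [|k IHk].
  rewrite expr0 -[1]/(1%:M) -eigenproj_sum.
  by apply: eq_bigr => a _; rewrite scale1r.
rewrite exprSr IHk -mulmxE mulmx_suml; apply: eq_bigr => a _.
by rewrite -scalemxAl eigenproj_mulmx scalerA exprSr.
Qed.

Lemma expmxZ_eigen (t : R) : expmx (t *: A) = \sum_(a <- s) expR (t * a) *: P a.
Proof.
have tAX k : (t *: A) ^+ k = t ^+ k *: A ^+ k.
  elim: k => [|k IHk]; first by rewrite !expr0 scale1r.
  by rewrite !exprS IHk -!mulmxE -scalemxAl -scalemxAr scalerA.
apply/matrixP => i j; rewrite mxE.
have -> : (fun k : nat => k`!%:R^-1 * ((t *: A) ^+ k) i j) =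
    (fun k => \sum_(a <- s) P a i j * exp_coeff (t * a) k).
  apply/funext => k; rewrite tAX mx_exp_eigen mxE summxE !mulr_sumr.
  apply: eq_bigr => a _; rewrite mxE /exp_coeff /= exprMn; ring.
apply: cvg_lim => //; rewrite summxE.
have -> : \sum_(a <- s) (expR (t * a) *: P a) i j =
    \sum_(a <- s) P a i j * expR (t * a).
  by apply: eq_bigr => a _; rewrite mxE mulrC.
have -> : series (fun k => \sum_(a <- s) P a i j * exp_coeff (t * a) k) =
    (fun k => \sum_(a <- s) P a i j * series (exp_coeff (t * a)) k).
  apply/funext => k; rewrite /series /= exchange_big /=.
  by apply: eq_bigr => a _; rewrite mulr_sumr.
elim: s => [|a r IHr].
  by under eq_fun do rewrite big_nil; rewrite big_nil; exact: cvg_cst.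
under eq_fun do rewrite big_cons; rewrite big_cons; apply: cvgD => //.
by apply: cvgMl_tmp; exact: is_cvg_series_exp_coeff.
Qed.

End SpectralDecomposition.

(** * Monotonicity and sign of exponential sums *)

Lemma is_derive_ge0_le (R : realType) (f f' : R -> R) :
  (forall x : R, is_derive x 1 f (f' x)) -> (forall x, 0 < x -> 0 <= f' x) ->
  forall s t, 0 <= s -> s <= t -> f s <= f t.
Proof.
move=> df f'0; apply: ger0_derive1_ndecry => [x _|x|].
- by case: (df x).
- rewrite in_itv/= andbT => /f'0.
  by rewrite derive1E (@derive_val _ _ _ _ _ _ _ (df x)).
- by apply: derivable_within_continuous => x _; case: (df x).
Qed.

(** Storing pairs (coefficient, rate) turns differentiation into a map on lists and lets sign
    conditions be checked term by term. *)
Definition expoly (R : realType) (p : seq (R * R)) (t : R) : R :=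
  \sum_(x <- p) x.1 * expR (t * x.2).

Definition deriv_expoly (R : realType) (p : seq (R * R)) : seq (R * R) :=
  [seq (x.1 * x.2, x.2) | x <- p].

Lemma is_derive_expoly (R : realType) (p : seq (R * R)) (t : R) :
  is_derive t 1 (expoly p) (expoly (deriv_expoly p) t).
Proof.
elim: p => [|[c l] p IHp].
  have -> : expoly [::] = cst (0 : R).
    by apply/funext => y; rewrite /expoly big_nil.
  exact: is_derive_cst.
have -> : expoly ((c, l) :: p) =
    (c \*: (expR \o *%R^~ l) : R -> R) + expoly p.
  by apply/funext => y; rewrite /expoly big_cons.
rewrite /expoly /= big_cons /=; apply: is_deriveD => /=.
rewrite -mulrA; apply: is_deriveZ.
rewrite mulrC; apply: is_derive1_comp.
have -> : *%R^~ l = (l \*: id : R -> R).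
  by apply/funext => y /=; rewrite mulrC.
by apply: is_derive_eq; rewrite /GRing.scale/= mulr1.
Qed.

(* The sign condition says that each term of [p] lies above its multiple of the
   common factor [expR (t * m)]. *)
Lemma expoly_ge0_pivot (R : realType) (p : seq (R * R)) (m t : R) :
  0 <= t -> {in p, forall x, 0 <= x.1 * (x.2 - m)} ->
  0 <= \sum_(x <- p) x.1 -> 0 <= expoly p t.
Proof.
move=> t0 pm p0.
apply: (@le_trans _ _ (\sum_(x <- p) x.1 * expR (t * m))).
  by rewrite -mulr_suml mulr_ge0 ?expR_ge0.
rewrite /expoly big_seq [leRHS]big_seq; apply: ler_sum => x /pm.
have [-> _|xm] := eqVneq x.2 m; first by [].
case: (ltgtP x.2 m) xm => // xm _.
  rewrite nmulr_lge0 ?subr_lt0// => x0.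
  by rewrite ler_wnM2l// ler_expR ler_wpM2l// ltW.
rewrite pmulr_lge0 ?subr_gt0// => x0.
by rewrite ler_wpM2l// ler_expR ler_wpM2l// ltW.
Qed.

(** The pivot criterion with rate [m] is applied to the derivative, so the sum is non-decreasing
    from its non-negative value at 0. *)
Lemma expoly_ge0 (R : realType) (p : seq (R * R)) (m t : R) :
  0 <= t -> 0 <= \sum_(x <- p) x.1 -> 0 <= \sum_(x <- p) x.1 * x.2 ->
  {in p, forall x, 0 <= x.1 * x.2 * (x.2 - m)} -> 0 <= expoly p t.
Proof.
move=> t0 p0 dp0 pm; apply: (@le_trans _ _ (expoly p 0)).
  by rewrite /expoly; under eq_bigr do rewrite mul0r expR0 mulr1.
apply: (is_derive_ge0_le (is_derive_expoly p)) => // x /ltW x0.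
apply: (expoly_ge0_pivot (m := m)) => //; last by rewrite big_map.
by move=> _ /mapP[y py ->]; exact: pm.
Qed.

Lemma expoly_gt0 (R : realType) (p : seq (R * R)) (t : R) :
  {in p, forall x, 0 <= x.1} -> 0 < \sum_(x <- p) x.1 -> 0 < expoly p t.
Proof.
move=> p0 sum_gt0.
have term_ge0 x : x \in p -> 0 <= x.1 * expR (t * x.2).
  by move=> /p0 x0; rewrite mulr_ge0 ?expR_ge0.
rewrite lt0r {2}/expoly [X in _ && (0 <= X)]big_seq sumr_ge0 // andbT.
apply: contraTneq sum_gt0; rewrite /expoly big_seq => /eqP.
rewrite psumr_eq0// => /allP p_eq0.
rewrite -leNgt big_seq big1// => x px; have := p_eq0 x px.
by rewrite px mulf_eq0 (gt_eqF (expR_gt0 _)) orbF => /eqP.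
Qed.

Lemma expoly_ratio_ndecr (R : realType) (p q : seq (R * R)) :
  (forall t, 0 < expoly q t) ->
  (forall t, 0 <= t -> 0 <= expoly (deriv_expoly p) t * expoly q t
                           - expoly p t * expoly (deriv_expoly q) t) ->
  forall s t, 0 <= s -> s <= t ->
    expoly p s / expoly q s <= expoly p t / expoly q t.
Proof.
move=> q0 Wpq.
pose h' t := (expoly (deriv_expoly p) t * expoly q t
              - expoly p t * expoly (deriv_expoly q) t) / expoly q t ^+ 2.
apply: (@is_derive_ge0_le _ (fun t => expoly p t / expoly q t) h') => x;
  last first.
  by move/ltW => x0; rewrite divr_ge0 ?Wpq// sqr_ge0.
have qx0 : expoly q x != 0 by rewrite gt_eqF.
have dV := is_deriveV qx0 (is_derive_expoly q x).
apply: (is_derive_eq (is_deriveM (is_derive_expoly p x) dV)).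
rewrite /h' /GRing.scale/=; field.
exact: qx0.
Qed.

(** * The Wronskian of two exponential sums *)

(** The list [p] is the Wronskian times [expR (t * (lj + lk))], and the pivot is [lj - li]. In the
    derivative the [jk] term vanishes and the [ik] term has exactly the pivot rate, so of the three
    pair terms only [ij] needs a sign. The product in [Dij] is its rate, its distance to the pivot
    and its own factor [lj - li]; [ijk] and [ikj] control the terms in [ai] and [aj]. *)
Lemma wronskian_ge0 (R : realType) (li lj lk ai aj ak bi bj bk c t : R)
    (li0 : 0 < li) (lj0 : 0 < lj) (lk0 : 0 < lk) (c0 : 0 <= c) (t0 : 0 <= t)
    (suma : c + ai + aj + ak = 1) (sumb : c + bi + bj + bk = 0)
    (bai : bi <= ai) (baj : bj <= aj) (bak : bk <= ak)
    (suml : li * bi + lj * bj + lk * bk <= 0)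
    (Dij : 0 <= (bi * aj - bj * ai) * ((lj - li) * (lk - li) * (lk - lj)))
    (bi_ge : 0 <= bi * (lj - li) * (lk - li) + c * lj * lk)
    (ijk : 0 <= lj + lk - li) (ikj : 0 <= li + lk - lj)
    (ei := expR (t * - li)) (ej := expR (t * - lj)) (ek := expR (t * - lk)) :
  0 <= c * (li * (ai - bi) * ei + lj * (aj - bj) * ej + lk * (ak - bk) * ek)
       + (lj - li) * (bi * aj - bj * ai) * ei * ej
       + (lk - li) * (bi * ak - bk * ai) * ei * ek
       + (lk - lj) * (bj * ak - bk * aj) * ej * ek.
Proof.
pose p := [:: ((lk - lj) * (bj * ak - bk * aj), 0);
  ((lk - li) * (bi * ak - bk * ai), lj - li);
  ((lj - li) * (bi * aj - bj * ai), lk - li);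
  (c * li * (ai - bi), lj + lk - li); (c * lj * (aj - bj), lk);
  (c * lk * (ak - bk), lj)].
have p0 : 0 <= expoly p t.
  have ak_eq : ak = 1 - c - ai - aj by lra.
  have bk_eq : bk = - c - bi - bj by lra.
  apply: (@expoly_ge0 _ _ (lj - li)) => //.
  (* At time 0 the two sums are [c + bi + bj + bk = 0] and [c + ai + aj + ak = 1], so the Wronskian
     collapses to minus the left side of [suml]. *)
  - rewrite /p !big_cons big_nil /= ak_eq bk_eq.
    move: suml; rewrite bk_eq; lra.
  - rewrite /p !big_cons big_nil /= ak_eq bk_eq.
    move: bi_ge; lra.
  - have mk : lj + lk - li - (lj - li) = lk by ring.
    have mj : lk - (lj - li) = li + lk - lj by ring.
    have mi : lj - (lj - li) = li by ring.
    move=> x; rewrite /p !inE.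
    case/orP=> [/eqP->|]/=; first by rewrite mulr0 mul0r.
    case/orP=> [/eqP->|]/=; first by rewrite subrr mulr0.
    case/orP=> [/eqP->|]/=; first by move: Dij; lra.
    case/orP=> [/eqP->|]/=; first by rewrite mk; repeat apply: mulr_ge0; lra.
    case/orP=> [/eqP->|/eqP->]/=.
      by rewrite mj; repeat apply: mulr_ge0; lra.
    by rewrite mi; repeat apply: mulr_ge0; lra.
have ei0 : ei != 0 by rewrite gt_eqF ?expR_gt0.
have ej0 : ej != 0 by rewrite gt_eqF ?expR_gt0.
have ek0 : ek != 0 by rewrite gt_eqF ?expR_gt0.
have eV l : expR (t * l) = (expR (t * - l))^-1 by rewrite mulrN expRN invrK.
(* Undo the multiplication by [expR (t * (lj + lk))]; by [eV] the growing exponentials become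
   inverses of [ej] and [ek], which [field] can clear. *)
have := mulr_ge0 p0 (mulr_ge0 (expR_ge0 (t * - lj)) (expR_ge0 (t * - lk))).
rewrite /expoly /p !big_cons big_nil /= !mulrDr !expRD mulr0 expR0.
rewrite !(eV lj) !(eV lk) -/ei -/ej -/ek; congr (0 <= _); field.
by rewrite ej0 ek0.
Qed.

(** Each case is [wronskian_ge0] for a cyclic permutation of the indices, which keeps the product of
    differences in [Dij] positive. The ordering gives both triangle inequalities in the first case;
    in each of the other two, one of them is [0 <= l1 + l2 - l3]. *)
Lemma exp_ratio_ndecr (R : realType) (l1 l2 l3 c a1 a2 a3 b1 b2 b3 : R)
    (S1 := l1 * b1 + l2 * b2 + l3 * b3)
    (S2 := l1 ^+ 2 * b1 + l2 ^+ 2 * b2 + l3 ^+ 2 * b3)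
    (f := expoly [:: (b1, - l1); (b2, - l2); (b3, - l3); (c, 0)])
    (g := expoly [:: (a1, - l1); (a2, - l2); (a3, - l3); (c, 0)])
    (l1_gt0 : 0 < l1) (l12 : l1 < l2) (l23 : l2 < l3)
    (c0 : 0 <= c) (a10 : 0 <= a1) (a20 : 0 <= a2) (a30 : 0 <= a3)
    (suma : c + a1 + a2 + a3 = 1) (sumb : c + b1 + b2 + b3 = 0)
    (ba1 : b1 <= a1) (ba2 : b2 <= a2) (ba3 : b3 <= a3) (S1_le0 : S1 <= 0)
    (cases :
      [\/ 0 <= S2 - S1 * (l2 + l3) /\ 0 <= b1 * a2 - b2 * a1,
          [/\ 0 <= S2 - S1 * (l1 + l2), b1 * a3 - b3 * a1 <= 0
            & 0 <= l1 + l2 - l3]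
        | [/\ 0 <= S2 - S1 * (l1 + l3), 0 <= b2 * a3 - b3 * a2
            & 0 <= l1 + l2 - l3]]) :
  forall s t, 0 <= s -> s <= t -> f s / g s <= f t / g t.
Proof.
apply: expoly_ratio_ndecr => t => [|t0].
  apply: expoly_gt0; last by rewrite !big_cons big_nil /=; lra.
  by apply/allP; rewrite /= a10 a20 a30 c0.
rewrite /deriv_expoly /expoly /= !big_cons !big_nil /= !mulr0 expR0.
have num_eq (x y : R) : 0 <= x -> x = y -> 0 <= y by move=> ? <-.
have l2_gt0 : 0 < l2 := lt_trans l1_gt0 l12.
have l3_gt0 : 0 < l3 := lt_trans l2_gt0 l23.
have l13 : l1 < l3 := lt_trans l12 l23.
rewrite /S1 /S2 in S1_le0 cases.
case: cases => [[S12 D12]|[S12 D13 l123]|[S12 D23 l123]].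
- apply: num_eq (@wronskian_ge0 _ l1 l2 l3 a1 a2 a3 b1 b2 b3 c t
    _ _ _ _ _ _ _ _ _ _ _ _ _ _ _) _; [try assumption..|]; try lra.
  + by repeat apply: mulr_ge0; lra.
  (* The left side of the first condition sums [b * ((x - l2) * (x - l3) - l2 * l3)] over the rates
     [x], including 0 with weight [c]. As the weights sum to 0, only the terms at [l1] and 0
     survive. The other two cases eliminate [b2] and [b1] likewise. *)
  + have b3E : b3 = - c - b1 - b2 by lra.
    by move: S12; rewrite b3E; lra.
- apply: num_eq (@wronskian_ge0 _ l3 l1 l2 a3 a1 a2 b3 b1 b2 c t
    _ _ _ _ _ _ _ _ _ _ _ _ _ _ _) _; [try assumption..|]; try lra.
  + by apply: mulr_ge0; [lra|apply: mulr_ge0; [apply: mulr_le0|]]; lra.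
  + have b2E : b2 = - c - b3 - b1 by lra.
    by move: S12; rewrite b2E; lra.
- apply: num_eq (@wronskian_ge0 _ l2 l3 l1 a2 a3 a1 b2 b3 b1 c t
    _ _ _ _ _ _ _ _ _ _ _ _ _ _ _) _; [try assumption..|]; try lra.
  + by apply: mulr_ge0; [lra|apply: mulr_le0; [apply: mulr_ge0_le0|]]; lra.
  + have b1E : b1 = - c - b2 - b3 by lra.
    by move: S12; rewrite b1E; lra.
Qed.

(** * The graph Laplacian and its kernel *)

Lemma laplacianE (R : realType) (V : finType) (E : rel V) i j :
  laplacian R E i j = (degree E (enum_val i))%:R *+ (i == j)
                      - (E (enum_val i) (enum_val j))%:R.
Proof. by rewrite !mxE. Qed.

Lemma tr_laplacian (R : realType) (V : finType) (E : rel V) :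
  symmetric E -> (laplacian R E)^T = laplacian R E.
Proof.
move=> symE; apply/matrixP => i j; rewrite mxE !laplacianE symE eq_sym.
by case: eqVneq => // ->.
Qed.

Lemma laplacian_entry_le0 (R : realType) (V : finType) (E : rel V) (u v : V) :
  u != v -> entry (laplacian R E) u v <= 0.
Proof.
move=> neq_uv; rewrite /entry laplacianE (inj_eq enum_rank_inj) (negPf neq_uv).
by rewrite mulr0n sub0r oppr_le0.
Qed.

(** A kernel vector has zero Dirichlet energy; being a sum of squares over edges, this forces equal
    values at adjacent vertices, and connectedness propagates them. *)
Lemma laplacian_ker_const (R : realType) (V : finType) (E : rel V)
    (w : 'rV[R]_#|V|) :
  symmetric E -> (forall x y, connect E x y) -> w *m laplacian R E = 0 ->
  forall i j, w 0 i = w 0 j.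
Proof.
move=> symE connE wL0.
pose e (i j : 'I_#|V|) : R := (E (enum_val i) (enum_val j))%:R.
have degE (i : 'I_#|V|) : (degree E (enum_val i))%:R = \sum_j e i j.
  rewrite /e -(big_enum_val (fun y => (E (enum_val i) y)%:R : R)).
  rewrite /degree -sum1_card natr_sum big_mkcond; apply: eq_bigr => y _.
  by rewrite inE; case: (E _ _).
have wLj j : w 0 j * (\sum_i e j i) = \sum_i w 0 i * e i j.
  have /rowP/(_ j) := wL0; rewrite !mxE => /eqP.
  under eq_bigr do rewrite laplacianE mulrBr.
  rewrite sumrB subr_eq0 => /eqP <-.
  rewrite [RHS](bigD1 j)//= [X in _ + X]big1 => [|i /negPf ->].
    by rewrite eqxx addr0 degE.
  by rewrite mulr0n mulr0.
have dirichlet : \sum_i \sum_j e i j * (w 0 i - w 0 j) ^+ 2 = 0.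
  have e_sym i j : e i j = e j i by rewrite /e symE.
  (* The two double sums agree after exchanging [i] and [j], and each inner sum vanishes by
     [wLj]. *)
  have -> : \sum_i \sum_j e i j * (w 0 i - w 0 j) ^+ 2 =
     \sum_i \sum_j w 0 i * (w 0 i * e i j - w 0 j * e j i)
     + \sum_i \sum_j w 0 j * (w 0 j * e j i - w 0 i * e i j).
    rewrite -big_split; apply: eq_bigr => i _; rewrite -big_split.
    by apply: eq_bigr => j _ /=; rewrite (e_sym j i); ring.
  rewrite [X in _ + X]exchange_big /= -mulr2n.
  rewrite big1 ?mul0rn// => i _.
  by rewrite -mulr_sumr sumrB -mulr_sumr wLj subrr mulr0.
have edge x y : E x y -> w 0 (enum_rank x) = w 0 (enum_rank y).
  move=> Exy; apply/eqP; rewrite -subr_eq0 -sqrf_eq0; apply/eqP.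
  have ge0 i j : 0 <= e i j * (w 0 i - w 0 j) ^+ 2.
    by rewrite mulr_ge0 ?sqr_ge0.
  have := psumr_eq0P (fun i _ => sumr_ge0 _ (fun j _ => ge0 i j)) dirichlet.
  move=> /(_ (enum_rank x) isT) /(psumr_eq0P (fun j _ => ge0 _ j)).
  by move=> /(_ (enum_rank y) isT); rewrite /e !enum_rankK Exy mul1r.
have const x y : w 0 (enum_rank x) = w 0 (enum_rank y).
  have /connectP[p pE ->] := connE x y.
  by elim: p x pE => //= z p IHp x /andP[/edge -> /IHp].
by move=> i j; rewrite -(enum_valK i) -(enum_valK j).
Qed.

Theorem theorem2 (R : realType) (V : finType) (E : rel V) (d : nat)
    (lambda1 lambda2 lambda3 : R) (u v : V)
    (E_sym : symmetric E) (E_irr : irreflexive E)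
    (E_connected : forall x y : V, connect E x y)
    (E_regular : forall x : V, degree E x = d)
    (lambda1_gt0 : 0 < lambda1) (lambda12 : lambda1 < lambda2)
    (lambda23 : lambda2 < lambda3)
    (spectrum : eigenvalue (laplacian R E) =i
                  [:: 0; lambda1; lambda2; lambda3])
    (neq_uv : u != v)
    (Delta1_ge0 : 0 <= Delta E lambda1 u v)
    (Delta2_ge0 : 0 <= Delta E lambda2 u v)
    (Delta3_ge0 : 0 <= Delta E lambda3 u v)
    (cases :
      [\/ [/\ 0 <= entry (laplacian R E ^+ 2) u v
                   - entry (laplacian R E) u v * (lambda2 + lambda3)
            & 0 <= DeltaPair E lambda1 lambda2 u v],
          [/\ 0 <= entry (laplacian R E ^+ 2) u v
                   - entry (laplacian R E) u v * (lambda1 + lambda2),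
              DeltaPair E lambda1 lambda3 u v <= 0
            & 0 <= lambda1 + lambda2 - lambda3]
        | [/\ 0 <= entry (laplacian R E ^+ 2) u v
                   - entry (laplacian R E) u v * (lambda1 + lambda3),
              0 <= DeltaPair E lambda2 lambda3 u v
            & 0 <= lambda1 + lambda2 - lambda3]]) :
  forall s t : R, 0 <= s -> s <= t -> heat_ratio E u v s <= heat_ratio E u v t.
Proof.
have symL := tr_laplacian R E_sym.
have L_le0 := laplacian_entry_le0 R E neq_uv.
set L := laplacian R E in symL L_le0 spectrum cases *.
(* The eigenvalue 0 comes last to match the lists in [exp_ratio_ndecr]; rotating by 3 puts the list
   in increasing order. *)
pose S := [:: lambda1; lambda2; lambda3; 0].
have uniqS : uniq S.
  rewrite -(rot_uniq 3); apply: lt_sorted_uniq.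
  by rewrite /= lambda1_gt0 lambda12 lambda23.
have subS : {subset eigenvalue L <= S}.
  by move=> a; rewrite spectrum !inE orbC -!orbA.
pose P (a : R) := proj_entry E a u.
have heatE x t :
    entry (heat_kernel E t) u x = expoly [seq (P a x, - a) | a <- S] t.
  rewrite /entry /heat_kernel (expmxZ_eigen symL uniqS subS) summxE /expoly.
  by rewrite big_map; apply: eq_bigr => a _; rewrite mxE /= mulrC mulrN mulNr.
have powE x k : entry (L ^+ k) u x = \sum_(a <- S) a ^+ k * P a x.
  rewrite /entry (mx_exp_eigen symL uniqS subS) summxE.
  by apply: eq_bigr => a _; rewrite mxE.
have Puu_ge0 a : a \in S -> 0 <= P a u.
  move=> aS.
  rewrite /P /proj_entry /entry -(eigenproj_gram symL uniqS subS aS) mxE.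
  by apply: sumr_ge0 => k _; rewrite [_^T _ _]mxE -expr2 sqr_ge0.
(* Each row of the projection for 0 lies in the kernel of [L], hence is constant; this is why both
   sums share the same constant term [c]. *)
have P0_const : P 0 u = P 0 v.
  have rowL0 : row (enum_rank u) (eigenproj L 0) *m L = 0.
    by rewrite -row_mul eigenproj_mulmx scale0r row0.
  have := laplacian_ker_const E_sym E_connected rowL0.
  by move=> /(_ (enum_rank u) (enum_rank v)); rewrite ![row _ _ _ _]mxE.
have sumS (F : R -> R) : \sum_(a <- S) F a =
    F lambda1 + F lambda2 + F lambda3 + F 0.
  by rewrite !big_cons big_nil addr0 !addrA.
(* The zeroth power of [L] yields the two normalisations: total 1 at [u] and 0 at [v]. *)
have sumP x : P 0 x + P lambda1 x + P lambda2 x + P lambda3 x = (u == x)%:R.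
  transitivity (entry (L ^+ 0) u x); last first.
    by rewrite /entry expr0 mxE (inj_eq enum_rank_inj).
  by rewrite powE sumS !expr0 !mul1r [RHS]addrC !addrA.
have powSE k : entry (L ^+ k.+1) u v = lambda1 ^+ k.+1 * P lambda1 v
    + lambda2 ^+ k.+1 * P lambda2 v + lambda3 ^+ k.+1 * P lambda3 v.
  by rewrite powE sumS [0 ^+ k.+1]expr0n /= mul0r [LHS]addr0.
move=> s t s0 st; rewrite /heat_ratio !heatE /= oppr0 -P0_const.
rewrite powSE -[L]expr1 powSE !expr1 in cases.
rewrite -[L]expr1 powSE !expr1 in L_le0.
apply: exp_ratio_ndecr => //.
- by apply: Puu_ge0; rewrite !inE eqxx !orbT.
- by apply: Puu_ge0; rewrite !inE eqxx.
- by apply: Puu_ge0; rewrite !inE eqxx !orbT.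
- by apply: Puu_ge0; rewrite !inE eqxx !orbT.
- by rewrite sumP eqxx.
- by rewrite P0_const sumP (negPf neq_uv).
- by rewrite -subr_ge0.
- by rewrite -subr_ge0.
- by rewrite -subr_ge0.
Qed.
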